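(* Let $p_4(n)$ denote the number of $2$-color partitions of $n$ in which one of the two colors appears only in parts that are multiples of $4$; equivalently, $$\sum_{n\ge 0}p_4(n)q^n=\frac{1}{(q;q)_\infty(q^4;q^4)_\infty},\quad |q|<1,$$ where $(a;q)_\infty=\prod_{j\ge 0}(1-aq^j)$. Then for every nonnegative integer $n$ and each $t\in\{11,25,32,39\}$, $$p_4(49n+t)\equiv 0\pmod{7}.$$
   Context: A $2$-color partition of $n$ is a partition of $n$ in which each part is assigned one of two colors; $p_4(n)$ counts those where parts of the second color must be multiples of $4$. *)

(* Defs.v *)
From mathcomp Require Import all_boot.

Set Implicit Arguments.
Unset Strict Implicit.
Unset Printing Implicit Defensive.

(* A 2-color partition of n is the multiset of its colored parts, given by     *)
(* multiplicities: [m (i, c)] is the number of parts of size i.+1 with color c *)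
(* ([false] is the first color, [true] the second). Every part of n is at most *)
(* n and occurs at most n times, so the bounds on both types lose nothing.     *)
Definition color_mult (n : nat) := {ffun 'I_n * bool -> 'I_n.+1}.

Definition is_2color_partition (n : nat) (m : color_mult n) : bool :=
  \sum_(x : 'I_n * bool) m x * x.1.+1 == n.

Definition second_color_mult4 (n : nat) (m : color_mult n) : bool :=
  [forall i : 'I_n, (0 < m (i, true)) ==> (4 %| i.+1)].

Definition p4 (n : nat) : nat :=
  #|[set m : color_mult n | is_2color_partition m & second_color_mult4 m]|.

(* Main.v *)
Require Import Defs.
From mathcomp Require Import all_boot all_algebra.
From mathcomp Require Import ring zify.

(* Write f_k for the product of the 1 - q^(k i). Replacing q by -q turns
   1 / (f_1 f_4) into f_1 / f_2^3, which modulo 7 is f_1 f_2^4 / f_14, and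
   f_1 f_2^4 = f_1^3 psi(q)^2 with psi = f_2^2 / f_1. By the identities of Jacobi
   and Gauss, the coefficient of q^(7n+4) in f_1^3 psi^2 is a sum over odd
   a^2 + b^2 + c^2 = 7 (8 n + 5) of +-a. Modulo 7 such a vector lies, up to signs
   and the exchange of b and c, on the line (1 : 2 : 4), and the corresponding
   sublattice of Z^3 is glued from a one-dimensional lattice and an Eisenstein
   lattice. The first one gives f_7 by Euler's identity, and the second one the
   CM form f_2^4, so that the coefficient is minus the coefficient of q^n in
   f_7 f_2^4. Hence the series of (-1)^n p_4(7n+4) is -f_7 f_2^3 modulo 7, and
   the exponents of f_2^3 lie, by Jacobi's identity, in the classes 0, 2 and 6
   modulo 7. *)

Set Implicit Arguments.
Unset Strict Implicit.
Unset Printing Implicit Defensive.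
Import GRing.Theory.

(** * Gaussian binomials and finite forms of the triple product and Jacobi identities *)

Section QSeries.
Local Open Scope ring_scope.

Section QBinomial.
Variables (A : comNzRingType).
Implicit Types (q a b : A) (n k m : nat).

Fixpoint qbin q n k : A :=
  match n, k with
  | _, 0 => 1
  | 0, _.+1 => 0
  | n'.+1, k'.+1 => qbin q n' k' + q ^+ k'.+1 * qbin q n' k'.+1
  end.

Definition qpoch q n : A := \prod_(i < n) (1 - q ^+ i.+1).

Lemma qbin0 q n : qbin q n 0 = 1. Proof. by case: n. Qed.

Lemma qbinS q n k :
  qbin q n.+1 k.+1 = qbin q n k + q ^+ k.+1 * qbin q n k.+1.
Proof. by []. Qed.

Lemma qbin_small q n k : (n < k)%N -> qbin q n k = 0.
Proof.
elim: n k => [|n IH] [|k] //= lt_nk.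
by rewrite !IH ?mulr0 ?addr0 // ltnW.
Qed.

Lemma qbinSr q n k : (k <= n)%N ->
  qbin q n.+1 k.+1 = q ^+ (n - k) * qbin q n k + qbin q n k.+1.
Proof.
elim: n k => [|n IH] [|k] //.
- by move=> _ /=; ring.
- move=> _; rewrite [X in _ = _ + X]qbinS [LHS]qbinS (IH 0%N) // !qbin0.
  by rewrite !subn0 !exprS; ring.
rewrite ltnS leq_eqVlt => /predU1P[->|lt_kn].
  rewrite subnn expr0 mul1r qbinS.
  by rewrite (@qbin_small _ n.+1 n.+2) // mulr0.
rewrite [in RHS](qbinS q n k) [in RHS](qbinS q n k.+1).
rewrite [LHS]qbinS (IH k) 1?ltnW // (IH k.+1) // subSS.
have -> : (n - k = (n - k.+1).+1)%N by lia.
rewrite !exprS; ring.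
Qed.

Lemma qpochS q n : qpoch q n.+1 = qpoch q n * (1 - q ^+ n.+1).
Proof. by rewrite /qpoch big_ord_recr. Qed.

Lemma qpoch0 q : qpoch q 0 = 1. Proof. exact: big_ord0. Qed.

Lemma qbin_qpoch q n k : (k <= n)%N ->
  qbin q n k * (qpoch q k * qpoch q (n - k)) = qpoch q n.
Proof.
elim: n k => [|n IH] [|k]; rewrite ?qbin0 ?subn0 ?qpoch0 ?mul1r //.
rewrite ltnS => le_kn; rewrite qbinS subSS [RHS]qpochS.
move: le_kn; rewrite leq_eqVlt => /predU1P[->|lt_kn].
  rewrite (@qbin_small _ n n.+1) // mulr0 addr0 subnn qpochS qpoch0 mulr1.
  by have := IH n (leqnn n); rewrite subnn qpoch0 mulr1 mulrA => ->.
have E1 := IH _ (ltnW lt_kn); have E2 := IH _ lt_kn.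
have -> : qpoch q n * (1 - q ^+ n.+1) =
    qpoch q n * (1 - q ^+ k.+1) + q ^+ k.+1 * (qpoch q n * (1 - q ^+ (n - k))).
  have -> : q ^+ n.+1 = q ^+ k.+1 * q ^+ (n - k) by rewrite -exprD; congr (q ^+ _); lia.
  ring.
rewrite -{1}E1 -E2; have -> : (n - k = (n - k.+1).+1)%N by lia.
rewrite !(qpochS q (n - _)) (qpochS q k); ring.
Qed.

Variables (q a b : A).
Hypothesis ab_q : a * b = q.

(* The term of index [k - m] of the bilateral theta series. *)
Definition tp_term m k : A :=
  if (m <= k)%N then a ^+ (k - m) * q ^+ 'C(k - m, 2)
  else b ^+ (m - k) * q ^+ 'C(m - k, 2).

Lemma tp_termSS m k : tp_term m.+1 k.+1 = tp_term m k.
Proof. by rewrite /tp_term ltnS !subSS. Qed.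

(** Passing from index [k] to [k.+1] costs a factor [a q^(k - m)], and the power of [q] occurring in
    [qbinSr] completes it to [a * q ^+ n]. Below the centre a factor [b] is lost instead, and
    [a * b = q] makes the two cases agree. *)
Lemma tp_term_up n m k : (k <= n + m)%N ->
  tp_term m k.+1 * q ^+ (n + m - k) = tp_term m k * (a * q ^+ n).
Proof.
move=> le_k; rewrite /tp_term; case: (leqP m k) => [le_mk|lt_km].
  rewrite leqW // subSn // binS bin1 exprS exprD.
  have -> : q ^+ n = q ^+ (k - m) * q ^+ (n + m - k).
    by rewrite -exprD; congr (q ^+ _); lia.
  ring.
have [d dE] : exists d, (m = k + d.+1)%N by exists (m - k.+1)%N; lia.
have -> : (m - k = d.+1)%N by lia.
have -> : (n + m - k = n + d.+1)%N by lia.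
case: (ltnP k m) lt_km => // _ _.
case: d dE => [|d] dE.
  have -> : (k.+1 - m = 0)%N by lia.
  have -> : (m <= k.+1)%N by lia.
  by rewrite !bin_small // !expr0 addn1 exprS expr1 -{1}ab_q; ring.
have -> : (m <= k.+1)%N = false by lia.
have -> : (m - k.+1 = d.+1)%N by lia.
have -> : q ^+ (n + d.+2) = a * b * q ^+ n * q ^+ d.+1.
  by rewrite ab_q exprD [q ^+ d.+2]exprS; ring.
by rewrite (binS d.+1 1) bin1 exprD [b ^+ d.+2]exprS; ring.
Qed.

Lemma tp_term_down m k : tp_term m.+1 k * q ^+ k = tp_term m k * (b * q ^+ m).
Proof.
rewrite /tp_term; case: (ltnP m k) => [lt_mk|le_km].
  have [d ->] : exists d, (k = m + d.+1)%N by exists (k - m.+1)%N; lia.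
  have -> : (m <= m + d.+1)%N by lia.
  have -> : (m + d.+1 - m.+1 = d)%N by lia.
  have -> : (m + d.+1 - m = d.+1)%N by lia.
  have -> : q ^+ (m + d.+1) = a * b * q ^+ m * q ^+ d.
    by rewrite ab_q exprD [q ^+ d.+1]exprS; ring.
  by rewrite (binS d 1) bin1 exprD [a ^+ d.+1]exprS; ring.
have -> : (m.+1 - k = (m - k).+1)%N by lia.
have -> : q ^+ m = q ^+ (m - k) * q ^+ k by rewrite -exprD subnK.
rewrite (binS _ 1) bin1 exprD exprS.
case: ifP => [le_mk|_]; last by ring.
have -> : k = m by lia.
by rewrite subnn; ring.
Qed.

(** The weight [phi] is left free so that the same recurrences serve the theta sum itself and its
    derivative, where [phi k] is [k - m]. *)
Definition tp_sum n m (phi : nat -> A) : A :=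
  \sum_(k < (n + m).+1) phi k * tp_term m k * qbin q (n + m) k.

(** The second Pascal rule splits the sum; absorbing its power of [q] by [tp_term_up] turns the new
    factor [1 + a * q ^+ n] into an operator on [phi]. On a constant weight this operator is a plain
    multiplication. *)
Lemma tp_sum_recl n m phi :
  tp_sum n.+1 m phi = tp_sum n m (fun k => phi k + phi k.+1 * (a * q ^+ n)).
Proof.
rewrite /tp_sum addSn big_ord_recl qbin0 mulr1.
have split_term (k : 'I_(n + m).+1) :
    phi k.+1 * tp_term m k.+1 * qbin q (n + m).+1 k.+1 =
    phi k.+1 * tp_term m k.+1 * qbin q (n + m) k.+1
    + phi k.+1 * (a * q ^+ n) * tp_term m k * qbin q (n + m) k.
  have le_k : (k <= n + m)%N by rewrite -ltnS.
  rewrite qbinSr // -(mulrA (phi _) (a * _)) [a * _ * _]mulrC -tp_term_up //.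
  ring.
under eq_bigr => k _ do rewrite lift0 split_term.
rewrite big_split /= addrA; under [RHS]eq_bigr do rewrite 2!mulrDl.
rewrite big_split /=; congr (_ + _).
rewrite big_ord_recr /= (@qbin_small _ (n + m)) // mulr0 addr0.
by rewrite [RHS]big_ord_recl qbin0 mulr1.
Qed.

Lemma tp_sum_recr n m phi :
  tp_sum n m.+1 phi = tp_sum n m (fun k => phi k.+1 + phi k * (b * q ^+ m)).
Proof.
rewrite /tp_sum addnS big_ord_recl qbin0 mulr1.
under eq_bigr => k _ do rewrite lift0 qbinS mulrDr {1}tp_termSS.
rewrite big_split /= addrCA; under [RHS]eq_bigr do rewrite 2!mulrDl.
rewrite big_split /=; congr (_ + _).
rewrite big_ord_recr /= (@qbin_small _ (n + m)) // !mulr0 addr0.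
rewrite [RHS]big_ord_recl qbin0 mulr1; congr (_ + _).
  by rewrite -[tp_term m.+1 0]mulr1 -(expr0 q) tp_term_down; ring.
apply: eq_bigr => k _; rewrite lift0 mulrA -(mulrA (phi _)).
by rewrite tp_term_down; ring.
Qed.

Lemma finite_triple_product n m :
  tp_sum n m (fun=> 1) =
  (\prod_(i < n) (1 + a * q ^+ i)) * \prod_(i < m) (1 + b * q ^+ i).
Proof.
have scale n' m' phi c : tp_sum n' m' (fun k => phi k * c) = tp_sum n' m' phi * c.
  by rewrite /tp_sum mulr_suml; apply: eq_bigr => k _; ring.
elim: n => [|n IH].
  rewrite big_ord0 mul1r; elim: m => [|m IH].
    by rewrite /tp_sum big_ord1 big_ord0 /tp_term /= bin_small // !mulr1.
  rewrite tp_sum_recr big_ord_recr /= -IH -scale /tp_sum.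
  by apply: eq_bigr => k _; ring.
rewrite tp_sum_recl big_ord_recr /= mulrAC -IH -scale /tp_sum.
by apply: eq_bigr => k _; ring.
Qed.

End QBinomial.

(* The derivative of the finite triple product in the direction [a = - z] at
   the zero [z = 1], computed through the recurrence of the theta sums. *)
Lemma finite_jacobi (A : comNzRingType) (q : A) (n m : nat) :
  tp_sum q (-1) (- q) n.+1 m (fun k => k%:R - m%:R) = - (qpoch q n * qpoch q m).
Proof.
have abq : -1 * - q = q by ring.
(* The factor of index 0 in the triple product is [1 + a], which is zero at [a = -1]. *)
have S0 n' : tp_sum q (-1) (- q) n'.+1 m (fun=> 1) = 0.
  by rewrite (finite_triple_product abq) big_ord_recl expr0 mulr1 subrr !mul0r.
have S1 : tp_sum q (-1) (- q) 0 m (fun=> 1) = qpoch q m.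
  rewrite (finite_triple_product abq) big_ord0 mul1r.
  by apply: eq_bigr => i _; rewrite exprS; ring.
have step n' : tp_sum q (-1) (- q) n'.+1 m (fun k => k%:R - m%:R) =
    (1 - q ^+ n') * tp_sum q (-1) (- q) n' m (fun k => k%:R - m%:R)
    - q ^+ n' * tp_sum q (-1) (- q) n' m (fun=> 1).
  rewrite (tp_sum_recl abq) /tp_sum !mulr_sumr -sumrB.
  by apply: eq_bigr => k _; rewrite -natr1; ring.
elim: n => [|n IH].
  by rewrite step S1 expr0 subrr mul0r qpoch0; ring.
by rewrite step S0 IH qpochS; ring.
Qed.


End QSeries.

(** * Polynomials modulo [X^N], in place of power series *)

Section TruncatedSeries.
Local Open Scope ring_scope.
Variables (R : comNzRingType) (N : nat).
Implicit Types (p q r s : {poly R}) (d n k : nat).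

Definition eqX p q := forall i, (i < N)%N -> p`_i = q`_i.

Lemma eqX_refl p : eqX p p. Proof. by []. Qed.

Lemma eqX_sym p q : eqX p q -> eqX q p.
Proof. by move=> pq i /pq. Qed.

Lemma eqX_trans q p r : eqX p q -> eqX q r -> eqX p r.
Proof. by move=> pq qr i lt_iN; rewrite pq ?qr. Qed.

Lemma eqXM p q r s : eqX p q -> eqX r s -> eqX (p * r) (q * s).
Proof.
move=> pq rs i lt_iN; rewrite !coefM; apply: eq_bigr => j _.
by rewrite pq ?rs //; have := ltn_ord j; lia.
Qed.

Lemma eqX_sum (I : Type) (t : seq I) (P : pred I) (F G : I -> {poly R}) :
  (forall i, P i -> eqX (F i) (G i)) ->
  eqX (\sum_(i <- t | P i) F i) (\sum_(i <- t | P i) G i).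
Proof.
by move=> FG n lt_nN; rewrite !coef_sum; apply: eq_bigr => i /FG ->.
Qed.

Lemma eqX_Xn0 n p : (N <= n)%N -> eqX (p * 'X^n) 0.
Proof.
by move=> le_Nn i lt_iN; rewrite coefMXn coef0 (leq_trans lt_iN).
Qed.

Lemma eqX_comp_Xn d p q : (0 < d)%N -> eqX p q -> eqX (p \Po 'X^d) (q \Po 'X^d).
Proof.
move=> d_gt0 pq i lt_iN; rewrite !coef_comp_poly_Xn //; case: ifP => // _.
by rewrite pq // (leq_ltn_trans (leq_div i d)).
Qed.

(** A series with constant term 1 is invertible; the coefficients are compared by strong induction,
    so no inverse is formed. *)
Lemma eqX_cancel p q r : r`_0 = 1 -> eqX (r * p) (r * q) -> eqX p q.
Proof.
move=> r0 rpq i; elim/ltn_ind: i => i IH lt_iN.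
have := rpq i lt_iN; rewrite !coefM !big_ord_recl !subn0 r0 !mul1r.
rewrite [X in _ + X = _](eq_bigr (fun j : 'I_i => r`_(lift ord0 j) * q`_(i - lift ord0 j))).
  exact: addIr.
by move=> j _; rewrite IH // lift0; have := ltn_ord j; lia.
Qed.

Lemma coef0_qpoch d n : (0 < d)%N -> (qpoch ('X^d : {poly R}) n)`_0 = 1.
Proof.
move=> d_gt0; rewrite coef0_prod big1 // => i _.
rewrite coefB coef1 -exprM coefXn.
have -> : (0 == d * i.+1)%N = false by nia.
by rewrite subr0.
Qed.

Lemma eqX_qpoch d n : (0 < d)%N -> (N <= n.+1)%N ->
  eqX (qpoch 'X^d n) (qpoch 'X^d N).
Proof.
move=> d_gt0 le_Nn.
have step m : (N <= m.+1)%N -> eqX (qpoch 'X^d m.+1) (qpoch 'X^d m).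
  move=> le_Nm i lt_iN; rewrite qpochS mulrBr mulr1 coefB -exprM eqX_Xn0 ?coef0 ?subr0 //.
  nia.
have [E|ne_Nn] := eqVneq N n.+1.
  by have := step n le_Nn; rewrite -E => /eqX_sym.
have {ne_Nn}le_Nn : (N <= n)%N by lia.
elim: n le_Nn => [|n IH]; first by rewrite leqn0 => /eqP->.
rewrite leq_eqVlt => /predU1P[->//|]; rewrite ltnS => le_Nn.
by apply: eqX_trans (IH le_Nn); apply: step; lia.
Qed.

(** With both [k] and [n - k] at least [N], the three products in [qbin_qpoch] all agree with
    [qpoch 'X^d N] modulo [X^N], and one of them cancels. *)
Lemma eqX_qbin d n k : (0 < d)%N -> (N <= k)%N -> (N + k <= n)%N ->
  eqX (qbin 'X^d n k * qpoch 'X^d N) 1.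
Proof.
move=> d_gt0 le_Nk le_kn; have Qn0 := @coef0_qpoch d N d_gt0.
apply: (eqX_cancel Qn0); rewrite mulr1 mulrCA.
apply: eqX_trans (eqX_qpoch d_gt0 (_ : N <= n.+1)%N); last by lia.
rewrite -(@qbin_qpoch _ _ n k); last by lia.
by apply: eqXM => //; apply: eqXM; apply/eqX_sym/eqX_qpoch => //; lia.
Qed.

(** The passage to the limit: terms further than [N] from the centre [m] vanish modulo [X^N], and
    for the others [eqX_qbin] makes the Gaussian binomial cancel against [qpoch 'X^d N]. *)
Lemma eqX_tp_sum d (a b : {poly R}) n m (phi : nat -> {poly R}) :
  (0 < d)%N -> (2 * N <= n)%N -> (2 * N <= m)%N ->
  (forall k, (k + N < m)%N || (m + N < k)%N -> eqX (tp_term 'X^d a b m k) 0) ->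
  eqX (tp_sum 'X^d a b n m phi * qpoch 'X^d N)
      (\sum_(k < (n + m).+1) phi k * tp_term 'X^d a b m k).
Proof.
move=> d_gt0 le_n le_m tail; rewrite /tp_sum mulr_suml; apply: eqX_sum => k _.
rewrite -mulrA; case: (boolP ((k + N < m)%N || (m + N < k)%N)) => [/tail t0|].
  have phi0 : eqX (phi k * tp_term 'X^d a b m k) 0.
    by rewrite -(mulr0 (phi k)); apply: eqXM.
  apply: eqX_trans (eqX_sym phi0).
  by rewrite -[X in eqX _ X](mul0r (qbin 'X^d (n + m) k * qpoch 'X^d N)); apply: eqXM.
rewrite negb_or -!leqNgt => /andP[le1 le2].
rewrite -[X in eqX _ X]mulr1; apply: eqXM => //; apply: eqX_qbin => //; lia.
Qed.

End TruncatedSeries.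

(** * Theta series over a symmetric box of integers *)

Section Theta.
Local Open Scope ring_scope.

Definition zbox (K : nat) : seq int := [seq k%:Z - K%:Z | k <- iota 0 (K + K).+1].

Lemma mem_zbox K (j : int) : (j \in zbox K) = (`|j| <= K)%N.
Proof.
apply/mapP/idP => [[k]|le_jK]; first by rewrite mem_iota => lt_k ->; lia.
exists (absz (j + K%:Z)); last by lia.
by rewrite mem_iota; lia.
Qed.

Lemma zbox_uniq K : uniq (zbox K).
Proof. by rewrite map_inj_uniq ?iota_uniq // => i j; lia. Qed.

Lemma big_zbox (V : nmodType) K (F : int -> V) :
  \sum_(j <- zbox K) F j = \sum_(k < (K + K).+1) F (k%:Z - K%:Z).
Proof. by rewrite big_map -(big_mkord predT (fun k => F (k%:Z - K%:Z))) /index_iota subn0. Qed.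

(* The exponent [((u + v) j^2 + (u - v) j) / 2] of the theta series of base
   [X^(u + v)]. *)
Definition theta_exp (u v : nat) (j : int) : nat :=
  match j with
  | Posz k => u * k + (u + v) * 'C(k, 2)
  | Negz k => v * k.+1 + (u + v) * 'C(k.+1, 2)
  end.

Lemma theta_expE u v j :
  ((theta_exp u v j)%:Z * 2 = (u%:Z + v%:Z) * j ^+ 2 + (u%:Z - v%:Z) * j).
Proof.
have bin2z k : ('C(k, 2))%:Z * 2 = k%:Z * (k%:Z - 1).
  case: k => // k; rewrite bin2 /=.
  have := odd_double_half (k.+1 * k)%N; rewrite oddM /= andNb add0n.
  by rewrite -muln2 => /(congr1 Posz) E; move: E; rewrite !PoszM => ->; lia.
case: j => k; rewrite /theta_exp ?NegzE.
  by rewrite !PoszD !PoszM mulrDl -!mulrA bin2z PoszD; ring.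
by rewrite !PoszD !PoszM mulrDl -!mulrA bin2z PoszD; ring.
Qed.

Variable R : comNzRingType.

Lemma tp_term_theta (c : R) u v m k : c ^+ 2 = 1 ->
  tp_term ('X^(u + v) : {poly R}) (c *: 'X^u) (c *: 'X^v) m k =
  c ^+ `|k%:Z - m%:Z| *: 'X^(theta_exp u v (k%:Z - m%:Z)).
Proof.
move=> c2; rewrite /tp_term; case: leqP => [le_mk|lt_km].
  have -> : k%:Z - m%:Z = (k - m)%:Z by lia.
  by rewrite absz_nat /= exprZn -scalerAl -!exprM -exprD.
have [d ->] : exists d, m = (k + d.+1)%N by exists (m - k.+1)%N; lia.
have -> : k%:Z - (k + d.+1)%:Z = Negz d by lia.
have -> : (k + d.+1 - k = d.+1)%N by lia.
by rewrite /= exprZn -scalerAl -!exprM -exprD.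
Qed.

Lemma theta_exp_big N u v j : (0 < u + v)%N -> (0 < N)%N -> (N < `|j|)%N ->
  (N <= theta_exp u v j)%N.
Proof.
move=> uv_gt0 N_gt0 lt_Nj.
have binE k : (N < k)%N -> (N <= 'C(k, 2))%N.
  by case: k => [|[|k]]; [lia | lia | rewrite (binS k.+1 1) bin1; lia].
by case: j lt_Nj => k /= /binE; nia.
Qed.

Lemma theta_sum_eqX N (c : R) u v K (phi : int -> R) :
  (0 < u + v)%N -> (0 < N)%N -> (2 * N <= K)%N -> c ^+ 2 = 1 ->
  eqX N (tp_sum 'X^(u + v) (c *: 'X^u) (c *: 'X^v) K K
           (fun k => (phi (k%:Z - K%:Z))%:P) * qpoch 'X^(u + v) N)
    (\sum_(j <- zbox K) (phi j * c ^+ `|j|) *: 'X^(theta_exp u v j)).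
Proof.
move=> uv_gt0 N_gt0 le_NK c2.
apply: eqX_trans (eqX_tp_sum _ uv_gt0 le_NK le_NK _) _.
  move=> k kK; rewrite tp_term_theta // -mul_polyC.
  by apply: eqX_Xn0; apply: theta_exp_big => //; lia.
rewrite big_zbox; apply: eqX_sum => k _.
by rewrite tp_term_theta // mul_polyC scalerA.
Qed.
End Theta.

(** * The identities of Euler, Gauss and Jacobi modulo [X^N] *)

Section ThetaProducts.
Local Open Scope ring_scope.
Variable R : comNzRingType.
Implicit Types (d n M N K : nat).

(** The product [f_d], cut off after [n] factors. *)
Definition eul d n : {poly R} := qpoch 'X^d n.

Definition oddp (c : R) d M : {poly R} := \prod_(i < M) (1 + c *: 'X^(d * i.*2.+1)).

Lemma eul_comp_Xn d e n : eul d n \Po 'X^e = eul (e * d) n.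
Proof.
rewrite /eul /qpoch rmorph_prod; apply: eq_bigr => i _ /=.
by rewrite rmorphB rmorph1 /= -!exprM comp_Xn_poly -exprM mulnA.
Qed.

Lemma eul_even_odd d M : eul d M.*2 = eul d.*2 M * oddp (-1) d M.
Proof.
elim: M => [|M IH]; first by rewrite /eul /oddp !qpoch0 big_ord0 mulr1.
rewrite doubleS /eul !qpochS -/(eul _ _) IH /oddp big_ord_recr /= -!exprM scaleN1r.
by rewrite (_ : d * M.*2.+2 = d.*2 * M.+1)%N; [rewrite /eul; ring | lia].
Qed.

Lemma oddp_square d M : oddp 1 d M * oddp (-1) d M = oddp (-1) d.*2 M.
Proof.
rewrite -big_split /=; apply: eq_bigr => i _.
by rewrite (_ : d.*2 * i.*2.+1 = d * i.*2.+1 * 2)%N ?exprM;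
  [rewrite !scaleN1r !scale1r; ring | lia].
Qed.

Lemma eul_comp_opp M : eul 1 M.*2 \Po (- 'X) = eul 2 M * oddp 1 1 M.
Proof.
elim: M => [|M IH]; first by rewrite /eul /oddp !qpoch0 big_ord0 mulr1 comp_polyC.
rewrite doubleS /eul !qpochS !rmorphM /= -/(eul _ _) IH /oddp big_ord_recr /=.
rewrite !rmorphB /= !rmorph1 -!exprM !mul1n !comp_Xn_poly scale1r.
have sgn n : (-1) ^+ n.*2 = 1 :> {poly R} by rewrite -signr_odd odd_double.
rewrite ![(- 'X) ^+ _]exprNn -doubleS sgn exprS sgn.
by rewrite (mul2n M.+1) /eul; ring.
Qed.

(** A finite form of [f_1(-q) f_1(q) f_4 = f_2^3]. The unequal lengths [M] and [M.*2] make it an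
    exact identity of polynomials. *)
Lemma eul_sign_product M :
  (eul 1 M.*2 \Po (- 'X)) * eul 1 M.*2 * eul 4 M = eul 2 M ^+ 2 * eul 2 M.*2.
Proof.
rewrite eul_comp_opp (eul_even_odd 2) -(oddp_square 1) (eul_even_odd 1).
rewrite -[1.*2]/2%N -[2.*2]/4%N; ring.
Qed.

(** Triple product with [a = -X], [b = -X^2] and base [X^3]: the three products run over the residue
    classes modulo 3 and together give [f_1]. *)
Lemma euler_theta N K : (0 < N)%N -> (2 * N <= K)%N ->
  eqX N (eul 1 N) (\sum_(j <- zbox K) (-1) ^+ `|j| *: 'X^(theta_exp 1 2 j)).
Proof.
move=> N_gt0 le_NK; have c2 : (-1 : R) ^+ 2 = 1 by rewrite sqrrN expr1n.
have := @theta_sum_eqX R N (-1) 1 2 K (fun=> 1) isT N_gt0 le_NK c2.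
under eq_bigr do rewrite mul1r.
apply: eqX_trans; rewrite polyC1 finite_triple_product; last first.
  by rewrite -scalerAl -scalerAr scalerA -exprD mulrNN mulr1 scale1r.
apply: eqX_trans (eqX_sym (@eqX_qpoch R N 1 (3 * K) isT _)) _; first by lia.
have -> : qpoch 'X^1 (3 * K) = (\prod_(i < K) (1 + -1 *: 'X^1 * 'X^(1 + 2) ^+ i) *
    \prod_(i < K) (1 + -1 *: 'X^2 * 'X^(1 + 2) ^+ i)) * qpoch 'X^(1 + 2) K :> {poly R}.
  elim: {le_NK} K => [|K IH]; first by rewrite !qpoch0 !big_ord0 !mulr1.
  rewrite mulnS !addSn add0n !qpochS IH !big_ord_recr /= !scaleN1r !mulNr -!exprM -!exprD.
  rewrite !mul1n.
  by rewrite (_ : 3 * K.+1 = (3 * K).+3)%N ?mulnS // !addSn !add0n; ring.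
by apply: eqXM => //; apply: eqX_qpoch => //; lia.
Qed.

(** Triple product with [a = X], [b = X^3] and base [X^4]. The exponents [2 j^2 - j] run over the
    triangular numbers, so the sum is [psi]; its product is [oddp 1 1] times [f_4], and the even-odd
    splittings of [f_1] and [f_2] do the rest. *)
Lemma gauss_theta N K : (0 < N)%N -> (2 * N <= K)%N ->
  eqX N (eul 1 N * \sum_(j <- zbox K) 'X^(theta_exp 1 3 j)) (eul 2 N ^+ 2).
Proof.
move=> N_gt0 le_NK.
have := @theta_sum_eqX R N 1 1 3 K (fun=> 1) isT N_gt0 le_NK (expr1n _ _).
under eq_bigr do rewrite expr1n mul1r scale1r.
rewrite polyC1 finite_triple_product; last by rewrite !scale1r -exprD.
have -> : \prod_(i < K) (1 + 1 *: 'X^1 * 'X^(1 + 3) ^+ i) *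
    \prod_(i < K) (1 + 1 *: 'X^3 * 'X^(1 + 3) ^+ i) = oddp 1 1 K.*2 :> {poly R}.
  rewrite /oddp; elim: {le_NK} K => [|K IH]; first by rewrite !big_ord0 mulr1.
  rewrite doubleS !big_ord_recr /= -IH !scale1r -!exprM -!exprD !mul1n.
  rewrite (_ : 1 + 4 * K = K.*2.*2.+1)%N; last by lia.
  rewrite (_ : 3 + 4 * K = K.*2.+1.*2.+1)%N; last by lia.
  ring.
move/eqX_sym=> theta.
apply: eqX_trans (eqXM (eqX_sym (@eqX_qpoch R N 1 K.*2.*2 isT _)) theta) _.
  by lia.
apply: (@eqX_trans _ _ (eul 2 K.*2 * eul 2 K.*2.*2)); last first.
  by rewrite expr2; apply: eqXM; apply: eqX_qpoch => //; lia.
rewrite [eul 2 K.*2.*2]eul_even_odd -(oddp_square 1).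
rewrite -/(eul 1 _) (eul_even_odd 1).
set A := eul 2 _; set B := oddp _ _ _; set C := oddp _ _ _.
rewrite (_ : A * B * (C * qpoch 'X^(1 + 3) N) = A * (C * B) * qpoch 'X^4 N).
  rewrite -mulrA [_ * qpoch _ _]mulrC; apply: eqXM => //; apply: eqXM => //.
  by apply/eqX_sym/eqX_qpoch => //; lia.
by rewrite addSn; ring.
Qed.

(** Jacobi's identity in bilateral form: [j] and [1 - j] share an exponent, and their weights add up
    to the usual coefficient [(-1)^j (1 - 2 j)]. Two factors [f_1] come from [finite_jacobi] and the
    third from the limit. *)
Lemma jacobi_theta N K : (0 < N)%N -> (2 * N <= K)%N ->
  eqX N (eul 1 N ^+ 3)
    (\sum_(j <- zbox K) (- j%:~R * (-1) ^+ `|j|) *: 'X^(theta_exp 0 1 j)).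
Proof.
move=> N_gt0 le_NK; have c2 : (-1 : R) ^+ 2 = 1 by rewrite sqrrN expr1n.
have := @theta_sum_eqX R N (-1) 0 1 K (fun j => - j%:~R) isT N_gt0 le_NK c2.
apply: eqX_trans; rewrite expr0 /=.
case: K le_NK => [|K] le_NK; first by lia.
rewrite scaleN1r expr1; have -> : -1 *: 'X = - 'X :> {poly R} by rewrite scaleN1r.
have -> : tp_sum 'X (-1) (- 'X) K.+1 K.+1 (fun k => (- (k%:Z - K.+1%:Z)%:~R)%:P) =
    qpoch 'X K * qpoch 'X K.+1 :> {poly R}.
  rewrite -[RHS]opprK -finite_jacobi /tp_sum -sumrN; apply: eq_bigr => k _.
  by rewrite polyCN intrB polyCB -!pmulrn !polyC_natr; ring.
rewrite exprSr expr2; apply: eqXM => //.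
by apply: eqXM; apply: eqX_sym; apply: (@eqX_qpoch R N 1) => //; lia.
Qed.
End ThetaProducts.

(** * Weighted sums over lattice points, with values in ['F_7] *)

Section LatticeSums.
Local Open Scope ring_scope.

Definition zbox3 K : seq (int * int * int) :=
  [seq (ab, c) | ab <- [seq (a, b) | a <- zbox K, b <- zbox K], c <- zbox K].

Lemma mem_zbox3 K a b c :
  ((a, b, c) \in zbox3 K) = [&& `|a| <= K, `|b| <= K & `|c| <= K]%N.
Proof.
have mem_pairs (S T : eqType) (s : seq S) (t : seq T) x y :
    ((x, y) \in [seq (x, y) | x <- s, y <- t]) = (x \in s) && (y \in t).
  apply/allpairsP/andP => [[[x' y'] /= [? ? [-> ->]]] | [xs yt]] //.
  by exists (x, y).
by rewrite -!mem_zbox andbA -!mem_pairs.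
Qed.

Lemma zbox3_uniq K : uniq (zbox3 K).
Proof.
have uniq_pairs (S T : eqType) (s : seq S) (t : seq T) :
    uniq s -> uniq t -> uniq [seq (x, y) | x <- s, y <- t].
  by move=> us ut; apply: allpairs_uniq => // -[? ?] [? ?].
exact: uniq_pairs _ _ _ _ (uniq_pairs _ _ _ _ (zbox_uniq K) (zbox_uniq K)) (zbox_uniq K).
Qed.

Lemma big_zbox3 (V : nmodType) K (F : int -> int -> int -> V) :
  \sum_(a <- zbox K) \sum_(b <- zbox K) \sum_(c <- zbox K) F a b c =
  \sum_(v <- zbox3 K) F v.1.1 v.1.2 v.2.
Proof. by rewrite /zbox3 !big_allpairs. Qed.

Implicit Types (P : int -> int -> int -> bool) (w : int -> int -> int -> int).

Definition zsum K P w : 'F_7 :=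
  \sum_(v <- zbox3 K | P v.1.1 v.1.2 v.2) (w v.1.1 v.1.2 v.2)%:~R.

Lemma dvd7_F7 (z : int) : (z%:~R == 0 :> 'F_7) = (7 %| z)%Z.
Proof.
rewrite dvdzE /= (dvdn_pcharf (pchar_Fp (isT : prime 7))).
by case: z => k /=; rewrite ?NegzE ?rmorphN ?oppr_eq0 /= -?pmulrn.
Qed.

Lemma eq_F7 (y z : int) : (7 %| y - z)%Z -> y%:~R = z%:~R :> 'F_7.
Proof. by rewrite -dvd7_F7 rmorphB subr_eq0 => /eqP. Qed.

(** Terms with weight divisible by 7 contribute nothing, so the two maps need to be mutually inverse
    only on the remaining points, and to preserve the weight only modulo 7. *)
Lemma sum_F7_reindex (T : eqType) (s : seq T) (P P' : pred T)
    (w w' : T -> int) (g g' : T -> T) :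
  uniq s -> {subset P <= s} -> {subset P' <= s} ->
  (forall v, P v -> ~~ (7 %| w v)%Z ->
     [/\ P' (g v), g' (g v) = v & (7 %| w v - w' (g v))%Z]) ->
  (forall v, P' v -> ~~ (7 %| w' v)%Z ->
     [/\ P (g' v), g (g' v) = v & (7 %| w' v - w (g' v))%Z]) ->
  \sum_(v <- s | P v) (w v)%:~R = \sum_(v <- s | P' v) (w' v)%:~R :> 'F_7.
Proof.
move=> uniq_s sP sP' gP g'P.
pose supp (Q : pred T) (u : T -> int) v := Q v && ~~ (7 %| u v)%Z.
have sum_supp (Q : pred T) u : \sum_(v <- s | Q v) (u v)%:~R =
    \sum_(v <- [seq v <- s | supp Q u v]) (u v)%:~R :> 'F_7.
  rewrite big_filter big_mkcondr /=; apply: eq_bigr => v _.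
  by rewrite -dvd7_F7; case: eqP.
have GP v : supp P w v ->
    [/\ supp P' w' (g v), g' (g v) = v & (w v)%:~R = (w' (g v))%:~R :> 'F_7].
  case/andP=> Pv wv; have [P'g -> /eq_F7 E] := gP v Pv wv; split=> //.
  by rewrite /supp P'g -dvd7_F7 -E dvd7_F7.
have G'P v : supp P' w' v -> supp P w (g' v) /\ g (g' v) = v.
  case/andP=> Pv wv; have [Pg -> /eq_F7 E] := g'P v Pv wv; split=> //.
  by rewrite /supp Pg -dvd7_F7 -E dvd7_F7.
rewrite !sum_supp.
have perm_supp : perm_eq [seq g v | v <- s & supp P w v] [seq v <- s | supp P' w' v].
  apply: uniq_perm; last 1 first.
  - move=> v; rewrite mem_filter; apply/mapP/andP => [[u]|[Pv _]].
      rewrite mem_filter => /andP[/GP[P'u _ _] _] ->; split=> //.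
      by apply: sP'; case/andP: P'u.
    have [P'v E] := G'P v Pv; exists (g' v) => //.
    by rewrite mem_filter P'v; apply: sP; case/andP: P'v.
  - rewrite map_inj_in_uniq ?filter_uniq // => u v.
    rewrite !mem_filter => /andP[/GP[_ Eu _] _] /andP[/GP[_ Ev _] _] E.
    by rewrite -Eu -Ev E.
  - exact: filter_uniq.
rewrite -(perm_big _ perm_supp) big_map !big_filter.
by apply: eq_bigr => v /GP[].
Qed.

Definition boxed K P := forall a b c, P a b c -> [&& `|a| <= K, `|b| <= K & `|c| <= K]%N.

Lemma zsum_reindex K P P' w w' (g g' : int -> int -> int -> int * int * int) :
  boxed K P -> boxed K P' ->
  (forall a b c, P a b c -> ~~ (7 %| w a b c)%Z -> let: (a', b', c') := g a b c in
     [/\ P' a' b' c', g' a' b' c' = (a, b, c) & (7 %| w a b c - w' a' b' c')%Z]) ->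
  (forall a b c, P' a b c -> ~~ (7 %| w' a b c)%Z -> let: (a', b', c') := g' a b c in
     [/\ P a' b' c', g a' b' c' = (a, b, c) & (7 %| w' a b c - w a' b' c')%Z]) ->
  zsum K P w = zsum K P' w'.
Proof.
move=> boxP boxP' gP g'P; rewrite /zsum.
apply: (@sum_F7_reindex _ _ _ _ (fun v => w v.1.1 v.1.2 v.2) (fun v => w' v.1.1 v.1.2 v.2)
  (fun v => g v.1.1 v.1.2 v.2) (fun v => g' v.1.1 v.1.2 v.2)).
- exact: zbox3_uniq.
- by move=> [[a b] c] /boxP; rewrite mem_zbox3.
- by move=> [[a b] c] /boxP'; rewrite mem_zbox3.
- by move=> [[a b] c] /= Pv wv; have := gP _ _ _ Pv wv; case: (g a b c) => [[]].
- by move=> [[a b] c] /= Pv wv; have := g'P _ _ _ Pv wv; case: (g' a b c) => [[]].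
Qed.

Lemma zsumD K P w w' : zsum K P (fun a b c => w a b c + w' a b c) = zsum K P w + zsum K P w'.
Proof. by rewrite /zsum -big_split; apply: eq_bigr => v _ /=; rewrite rmorphD. Qed.

Lemma zsumN K P w : zsum K P (fun a b c => - w a b c) = - zsum K P w.
Proof. by rewrite /zsum -sumrN; apply: eq_bigr => v _ /=; rewrite rmorphN. Qed.

Lemma zsum_split K P Q w :
  zsum K P w = zsum K (fun a b c => P a b c && Q a b c) w
             + zsum K (fun a b c => P a b c && ~~ Q a b c) w.
Proof. by rewrite /zsum (bigID (fun v => Q v.1.1 v.1.2 v.2)). Qed.

Lemma eq_zsum K P P' w w' :
  (forall a b c, P a b c = P' a b c) ->
  (forall a b c, P' a b c -> (7 %| w a b c - w' a b c)%Z) ->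
  zsum K P w = zsum K P' w'.
Proof.
move=> eP ew; rewrite /zsum; apply: eq_big => v; first exact: eP.
by rewrite eP => /ew/eq_F7.
Qed.

End LatticeSums.

(** * From three squares to the form [7 s^2 + 2 x^2 + 6 y^2] *)

Section TernaryForms.
Local Open Scope ring_scope.

(** On odd integers this is the nontrivial character modulo 4, and [par] below is the sign
    [(-1)^a]. *)
Definition chi4 (a : int) : int := if (a %% 4)%Z == 1 then 1 else -1.
Definition par (a : int) : int := if (a %% 2)%Z == 0 then 1 else -1.

Lemma chi4N a : (a %% 2)%Z = 1 -> chi4 (- a) = - chi4 a.
Proof. by rewrite /chi4; do 2!case: ifP; lia. Qed.

Lemma parN a : par (- a) = par a.
Proof. by rewrite /par; do 2!case: ifP; lia. Qed.

Implicit Types (P : int -> int -> int -> bool).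
Variables (n K : nat).
(** The bound is [7 (8 n + 5)]; as [|a| <= a^2] for integers, the box contains every solution of
    both equations below. *)
Hypothesis le_nK : (56 * n + 35 <= K)%N.

Definition three_squares (a b c : int) : bool :=
  a * a + b * b + c * c == 7 * (8 * n%:Z + 5).

(** The equation of [three_squares] multiplied by 3/7, in the coordinates of [Lset_Dset]. *)
Definition form_sxy (s x y : int) : bool :=
  7 * (s * s) + 2 * (x * x) + 6 * (y * y) == 24 * n%:Z + 15.

Lemma boxed_three_squares P :
  (forall a b c, P a b c -> three_squares a b c) -> boxed K P.
Proof. move=> PQ a b c /PQ; rewrite /three_squares => /eqP; nia. Qed.

Lemma boxed_form_sxy P :
  (forall a b c, P a b c -> form_sxy a b c) -> boxed K P.
Proof. move=> PQ a b c /PQ; rewrite /form_sxy => /eqP; nia. Qed.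

Definition Lset (a b c : int) : bool := [&& three_squares a b c,
  (a %% 2)%Z == 1, (b %% 2)%Z == 1, (c %% 2)%Z == 1,
  ((b - 2 * a) %% 7)%Z == 0 & ((c - 4 * a) %% 7)%Z == 0].

Definition Dset (s x y : int) : bool := [&& form_sxy s x y,
  (s %% 2)%Z == 1, ((x - y) %% 2)%Z == 0 & ((x + s) %% 3)%Z == 0].

(* [s] is the coordinate along (1, 1, 1), and [(x + y sqrt(-3)) / 2] is the
   Eisenstein integer coordinate of the orthogonal component. *)
Lemma Lset_Dset :
  zsum K Lset (fun a _ _ => chi4 a * a) =
  zsum K Dset (fun s x y => chi4 s * par x * (5 * y - x)).
Proof.
apply: (@zsum_reindex _ _ _ _ _
  (fun a b c => let y := ((3 * b - 2 * a - c) %/ 14)%Z in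
                (((a + b + c) %/ 7)%Z, a - b + 5 * y, y))
  (fun s x y => (((7 * s + 4 * x - 6 * y) %/ 3)%Z,
                 ((7 * s + x + 9 * y) %/ 3)%Z, ((7 * s - 5 * x - 3 * y) %/ 3)%Z))).
- by apply: boxed_three_squares => a b c /and5P[].
- by apply: boxed_form_sxy => a b c /and4P[].
- move=> a b c; rewrite /Lset => /and5P[Q oa ob oc /andP[b2a c4a]] _.
  have [k ak] : exists k, a = 2 * k + 1 by exists (a %/ 2)%Z; lia.
  have [t bt] : exists t, b = 2 * a + 7 * (2 * t + 1) by exists ((b - 2 * a) %/ 14)%Z; lia.
  have [r cr] : exists r, c = 4 * a + 7 * (2 * r + 1) by exists ((c - 4 * a) %/ 14)%Z; lia.
  have -> : ((3 * b - 2 * a - c) %/ 14)%Z = 3 * t - r + 1 by lia.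
  have -> : ((a + b + c) %/ 7)%Z = 2 * k + 2 * t + 2 * r + 3 by lia.
  subst a b c; split.
  + move: Q; rewrite /Dset /three_squares /form_sxy => /eqP Q.
    by apply/and4P; split; lia.
  + by congr (_, _, _); lia.
  (* From [3 a = 7 s + 4 x - 6 y] follow [a = 5 y - x] modulo 7 and, as [x] and [y] have the same
     parity, [a = s + 2 x] modulo 4. *)
  + by rewrite /chi4 /par; do 3!case: ifP; lia.
move=> s x y; rewrite /Dset => /and4P[Q os xy xs] _.
have [z sz] : exists z, s = 3 * z - x by exists ((x + s) %/ 3)%Z; lia.
have [k xk] : exists k, x = y + 2 * k by exists ((x - y) %/ 2)%Z; lia.
have -> : ((7 * s + 4 * x - 6 * y) %/ 3)%Z = 7 * z - x - 2 * y by lia.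
have -> : ((7 * s + x + 9 * y) %/ 3)%Z = 7 * z - 2 * x + 3 * y by lia.
have -> : ((7 * s - 5 * x - 3 * y) %/ 3)%Z = 7 * z - 4 * x - y by lia.
subst s x; split.
- move: Q; rewrite /Lset /three_squares /form_sxy => /eqP Q.
  by apply/and5P; split; lia.
- by congr (_, _, _); lia.
- by rewrite /chi4 /par; do 3!case: ifP; lia.
Qed.


Lemma F7_eqN0 (z : 'F_7) : z = - z -> z = 0.
Proof.
move=> zN; have : z *+ 2 = 0 by rewrite mulr2n {1}zN addNr.
by rewrite -mulr_natr => /eqP; rewrite mulf_eq0 => /orP[/eqP//|/eqP].
Qed.

Lemma sqr_mod7 (a : int) : [\/ (a * a %% 7)%Z = 0 /\ (a %% 7)%Z = 0,
  (a * a %% 7)%Z = 1 /\ (a %% 7)%Z != 0, (a * a %% 7)%Z = 2 /\ (a %% 7)%Z != 0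
  | (a * a %% 7)%Z = 4 /\ (a %% 7)%Z != 0].
Proof.
have [k [r [-> r7]]] : exists k r : int, a = 7 * k + r /\ -3 <= r <= 3.
  by exists ((a + 3) %/ 7)%Z, (((a + 3) %% 7)%Z - 3); lia.
have -> : ((7 * k + r) * (7 * k + r) = 7 * (7 * (k * k) + 2 * (k * r)) + r * r) by ring.
have [-> | [-> | [-> | [-> | [-> | [-> | ->]]]]]] :
    r = -3 \/ r = -2 \/ r = -1 \/ r = 0 \/ r = 1 \/ r = 2 \/ r = 3 by lia.
- by apply: Or43; lia.
- by apply: Or44; lia.
- by apply: Or42; lia.
- by apply: Or41; lia.
- by apply: Or42; lia.
- by apply: Or44; lia.
- by apply: Or43; lia.
Qed.

Lemma dvd7_sqrB (a b : int) : ((b * b - a * a) %% 7)%Z = 0 ->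
  ((b - a) %% 7)%Z = 0 \/ ((b + a) %% 7)%Z = 0.
Proof.
have -> : b * b - a * a = (b - a) * (b + a) by ring.
move=> E; have : (7 %| (b - a) * (b + a))%Z by apply/dvdz_mod0P.
rewrite dvdzE abszM Euclid_dvdM // => /orP[] H; [left | right]; apply/dvdz_mod0P.
all: by rewrite dvdzE.
Qed.

(** The class 3 modulo 4 selects one of each pair of odd numbers [b], [-b]; it is the class of
    [4 j - 1], which completes the square in the exponents of [psi]. *)
Definition Aset (a b c : int) : bool := [&& three_squares a b c,
  (a %% 2)%Z == 1, (b %% 4)%Z == 3 & (c %% 4)%Z == 3].

(** The nonzero squares modulo 7 are 1, 2 and 4, and three squares with [a] prime to 7 sum to 0 only
    if all three classes occur. So [b^2, c^2] are [4 a^2, 2 a^2] in one of two orders, which gives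
    the factor 2. In the first order [b] is [2 a] and [c] is [4 a] up to sign, and the signs may be
    fixed modulo 7 instead of modulo 4. *)
Lemma Aset_Lset :
  zsum K Aset (fun a _ _ => chi4 a * a) = 2 * zsum K Lset (fun a _ _ => chi4 a * a).
Proof.
pose Q (a b c : int) := ((b * b - 4 * (a * a)) %% 7)%Z == 0.
have a_neq0 a : ~~ (7 %| chi4 a * a)%Z -> (a %% 7)%Z != 0.
  by rewrite /chi4; case: ifP; lia.
have swap_bc : zsum K (fun a b c => Aset a b c && ~~ Q a b c) (fun a _ _ => chi4 a * a) =
               zsum K (fun a b c => Aset a b c && Q a b c) (fun a _ _ => chi4 a * a).
{ apply: (@zsum_reindex _ _ _ _ _ (fun a b c => (a, c, b)) (fun a b c => (a, c, b))).
  1,2: by apply: boxed_three_squares => a b c /andP[/and4P[]].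
  all: move=> a b c /andP[/and4P[sq oa ob oc] Qv] /a_neq0 a0; split=> //; last by lia.
  all: have sq7 : ((a * a + b * b + c * c) %% 7)%Z = 0
    by move: sq; rewrite /three_squares; lia.
  all: apply/andP; split;
    first by apply/and4P; split=> //; move: sq; rewrite /three_squares; lia.
  all: move: Qv; rewrite /Q.
  all: have [[a1 a1']|[a1 _]|[a1 _]|[a1 _]] := sqr_mod7 a;
       have [[b1 _]|[b1 _]|[b1 _]|[b1 _]] := sqr_mod7 b;
       have [[c1 _]|[c1 _]|[c1 _]|[c1 _]] := sqr_mod7 c; lia. }
rewrite (zsum_split K Aset Q) swap_bc mulr_natl mulr2n.
suff -> : zsum K (fun a b c => Aset a b c && Q a b c) (fun a _ _ => chi4 a * a) =
          zsum K Lset (fun a _ _ => chi4 a * a) by [].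
apply: (@zsum_reindex _ _ _ _ _
  (fun a b c => (a, if ((b - 2 * a) %% 7)%Z == 0 then b else - b,
                    if ((c - 4 * a) %% 7)%Z == 0 then c else - c))
  (fun a b c => (a, if (b %% 4)%Z == 3 then b else - b,
                    if (c %% 4)%Z == 3 then c else - c))).
- by apply: boxed_three_squares => a b c /andP[/and4P[]].
- by apply: boxed_three_squares => a b c /and5P[].
- move=> a b c /andP[/and4P[]]; rewrite /three_squares /Q => sq oa ob oc /eqP Qv /a_neq0 a0.
  have b2 : ((b * b - (2 * a) * (2 * a)) %% 7)%Z = 0 by lia.
  have c2 : ((c * c - (4 * a) * (4 * a)) %% 7)%Z = 0 by lia.
  have b7 := dvd7_sqrB b2; have c7 := dvd7_sqrB c2; split; last by rewrite subrr.
    by apply/and5P; rewrite /three_squares; split; do ?[case: ifP => ?]; lia.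
  congr (_, _, _).
    by case: (((b - 2 * a) %% 7)%Z =P 0) => ?; case: ifP; lia.
  by case: (((c - 4 * a) %% 7)%Z =P 0) => ?; case: ifP; lia.
move=> a b c /and5P[]; rewrite /three_squares => sq oa ob oc /andP[b7 c7] /a_neq0 a0.
have b2 : ((b * b - 4 * (a * a)) %% 7)%Z == 0.
  have [t ->] : exists t, b = 2 * a + 7 * t by exists ((b - 2 * a) %/ 7)%Z; lia.
  by rewrite (_ : _ - _ = 7 * (7 * (t * t) + 4 * (a * t))); [lia | ring].
split; last by rewrite subrr.
  apply/andP; split; last by rewrite /Q; case: ifP; lia.
  by apply/and4P; rewrite /three_squares; split; do ?[case: ifP => ?]; lia.
congr (_, _, _).
  by case: ((b %% 4)%Z =P 3) => ?; case: ifP; lia.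
by case: ((c %% 4)%Z =P 3) => ?; case: ifP; lia.
Qed.

End TernaryForms.

(** * Symmetries of the Eisenstein component *)

Section EisensteinSums.
Local Open Scope ring_scope.
Variables (n K : nat).
Hypothesis le_nK : (56 * n + 35 <= K)%N.

(** The reflection [y -> -y] negates the part of the weight that is linear in [y]. *)
Lemma zsum_Dset :
  zsum K (Dset n) (fun s x y => chi4 s * par x * (5 * y - x)) =
  - zsum K (Dset n) (fun s x _ => chi4 s * par x * x).
Proof.
rewrite -zsumN -[RHS]add0r.
rewrite -[0](_ : zsum K (Dset n) (fun s x y => 5 * (chi4 s * par x * y)) = 0).
  rewrite -zsumD; apply: eq_zsum => // s x y _.
  set u := chi4 s * par x.
  by have -> : u * (5 * y - x) - (5 * (u * y) - u * x) = 0 by ring.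
apply: F7_eqN0; rewrite -zsumN.
apply: (@zsum_reindex _ _ _ _ _ (fun s x y => (s, x, - y)) (fun s x y => (s, x, - y))).
1,2: by apply: (boxed_form_sxy le_nK) => a b c /and4P[].
all: move=> s x y /and4P[Q os xy xs] _; split; last 1 first;
  rewrite ?opprK //; first by rewrite !mulrN ?opprK ?subrr ?addNr.
all: move: Q; rewrite /Dset /form_sxy => /eqP Q; apply/and4P; split; lia.
Qed.

Definition Eset (s x y : int) : bool := [&& form_sxy n s x y,
  (s %% 6)%Z == 5, ((x - y) %% 2)%Z == 0 & (x %% 3)%Z == 1].

(** If 3 divides [s] it divides [x], and [x -> -x] cancels these points. On the others
    [(s, x) -> (-s, -x)] exchanges the classes of [s] modulo 3 and keeps the weight, since [chi4]
    and [x] both change sign. *)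
Lemma Dset_Eset :
  zsum K (Dset n) (fun s x _ => chi4 s * par x * x) =
  2 * zsum K Eset (fun s x _ => chi4 s * par x * x).
Proof.
rewrite (zsum_split K (Dset n) (fun s _ _ => (s %% 3)%Z == 0)).
rewrite (_ : zsum K (fun s x y => Dset n s x y && ((s %% 3)%Z == 0)) _ = 0); last first.
{ apply: F7_eqN0; rewrite -zsumN.
  apply: (@zsum_reindex _ _ _ _ _ (fun s x y => (s, - x, y)) (fun s x y => (s, - x, y))).
  1,2: by apply: (boxed_form_sxy le_nK) => a b c /andP[/and4P[]].
  all: move=> s x y /andP[/and4P[Q os xy xs] s3] _; split; last 1 first;
    rewrite ?opprK //; first by rewrite parN !mulrN ?opprK ?subrr ?addNr.
  all: move: Q; rewrite /Dset /form_sxy => /eqP Q.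
  all: by apply/andP; split=> //; apply/and4P; split; lia. }
rewrite add0r (zsum_split K _ (fun s _ _ => (s %% 3)%Z == 2)) mulr_natl mulr2n.
congr (_ + _).
  apply: eq_zsum => [s x y|s x y _]; last by rewrite subrr.
  by rewrite /Dset /Eset -!andbA; case: form_sxy => //=; lia.
apply: (@zsum_reindex _ _ _ _ _ (fun s x y => (- s, - x, y)) (fun s x y => (- s, - x, y))).
- by apply: (boxed_form_sxy le_nK) => a b c /andP[/andP[/and4P[]]].
- by apply: (boxed_form_sxy le_nK) => a b c /and4P[].
- move=> s x y /andP[/andP[/and4P[Q os xy xs] s3] s3'] _; split; rewrite ?opprK //.
    by move: Q; rewrite /Eset /form_sxy => /eqP Q; apply/and4P; split; lia.
  by rewrite parN chi4N ?(eqP os) // !mulrN !mulNr opprK subrr.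
move=> s x y /and4P[Q os xy xs] _; split; rewrite ?opprK //.
  move: Q; rewrite /Dset /form_sxy => /eqP Q.
  by apply/andP; split; [apply/andP; split; [apply/and4P; split|]|]; lia.
rewrite parN chi4N; last by lia.
by rewrite !mulrN !mulNr opprK subrr.
Qed.

Definition Oset (s x y : int) : bool := Eset s x y && ((x %% 2)%Z == 1).

Definition O4set (s x y : int) : bool := Oset s x y && (((x - y) %% 4)%Z == 0).

(* Rotation by a cube root of unity in the Eisenstein integers
   [(x + y sqrt(-3)) / 2] makes the trace sum to zero. *)
Lemma zsum_Eset_x : zsum K Eset (fun s x _ => chi4 s * x) = 0.
Proof.
pose W := zsum K Eset (fun s x _ => chi4 s * x).
have EW : W = zsum K Eset (fun s x y => chi4 s * ((- x - 3 * y) %/ 2)%Z).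
{ apply: (@zsum_reindex _ _ _ _ _
    (fun s x y => (s, ((- x + 3 * y) %/ 2)%Z, ((- x - y) %/ 2)%Z))
    (fun s x y => (s, ((- x - 3 * y) %/ 2)%Z, ((x - y) %/ 2)%Z))).
  1,2: by apply: (boxed_form_sxy le_nK) => a b c /and4P[].
  all: move=> s x y /and4P[]; rewrite /form_sxy => Q os xy x3 _.
  all: have [k xk] : exists k, x = y + 2 * k by exists ((x - y) %/ 2)%Z; lia.
  - have -> : ((- x + 3 * y) %/ 2)%Z = y - k by lia.
    have -> : ((- x - y) %/ 2)%Z = - y - k by lia.
    subst x; split; first by apply/and4P; rewrite /form_sxy; split; lia.
      by congr (_, _, _); lia.
    by have -> : ((- (y - k) - 3 * (- y - k)) %/ 2)%Z = y + 2 * k; [lia | rewrite subrr].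
  have -> : ((- x - 3 * y) %/ 2)%Z = - 2 * y - k by lia.
  have -> : ((x - y) %/ 2)%Z = k by lia.
  subst x; split; first by apply/and4P; rewrite /form_sxy; split; lia.
    by congr (_, _, _); lia.
  by rewrite subrr. }
have EW' : W = zsum K Eset (fun s x y => chi4 s * ((- x + 3 * y) %/ 2)%Z).
{ rewrite EW.
  apply: (@zsum_reindex _ _ _ _ _ (fun s x y => (s, x, - y)) (fun s x y => (s, x, - y))).
  1,2: by apply: (boxed_form_sxy le_nK) => a b c /and4P[].
  all: move=> s x y /and4P[]; rewrite /form_sxy => Q os xy x3 _.
  all: rewrite ?opprK; split=> //; last by rewrite ?mulrN ?opprK subrr.
  all: by apply/and4P; rewrite /form_sxy; split; lia. }
have W3 : W + W + W = 0.
  rewrite {2}EW {2}EW' /W -!zsumD /zsum big1 // => -[[s x] y] /= /and4P[_ _ xy _].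
  rewrite (_ : _ + _ = 0) // -!mulrDr.
  by have -> : x + ((- x - 3 * y) %/ 2)%Z + ((- x + 3 * y) %/ 2)%Z = 0; [lia | rewrite mulr0].
have : W *+ 3 = 0 by rewrite -{}W3 !mulrS mulr0n addr0 addrA.
by rewrite -mulr_natr => /eqP; rewrite mulf_eq0 => /orP[/eqP//|/eqP].
Qed.

(** Without [par] the sum vanishes by [zsum_Eset_x], so its even part is minus its odd part; [par]
    negates the odd part, and the two become equal. *)
Lemma zsum_Eset : zsum K Eset (fun s x _ => chi4 s * par x * x) =
  - 2 * zsum K Oset (fun s x _ => chi4 s * x).
Proof.
have Even : zsum K (fun s x y => Eset s x y && ~~ ((x %% 2)%Z == 1))
      (fun s x _ => chi4 s * x) =
    - zsum K Oset (fun s x _ => chi4 s * x).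
  by apply/eqP; rewrite -addr_eq0 addrC -zsum_split zsum_Eset_x.
rewrite (zsum_split K Eset (fun _ x _ => (x %% 2)%Z == 1)).
rewrite -[X in _ + X = _](@eq_zsum K _ _ (fun s x _ => chi4 s * x) _
  (fun _ _ _ => erefl)); last first.
  by move=> s x y /andP[_ x2]; rewrite /par; case: ifP; [rewrite mulr1 subrr | lia].
rewrite Even -[X in X + _ = _](@eq_zsum K _ _ (fun s x _ => - (chi4 s * x)) _
  (fun _ _ _ => erefl)); last first.
  by move=> s x y /andP[_ x2]; rewrite /par; case: ifP; [lia | rewrite mulrN1 mulNr subrr].
by rewrite zsumN -/Oset; ring.
Qed.

(** For odd [x] and [y] exactly one of [x - y] and [x + y] is divisible by 4, and [y -> -y]
    exchanges the two cases. *)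
Lemma zsum_Oset_x : zsum K Oset (fun s x _ => chi4 s * x) =
  2 * zsum K O4set (fun s x _ => chi4 s * x).
Proof.
rewrite (zsum_split K Oset (fun _ x y => ((x - y) %% 4)%Z == 0)) mulr_natl mulr2n.
congr (_ + _).
apply: (@zsum_reindex _ _ _ _ _ (fun s x y => (s, x, - y)) (fun s x y => (s, x, - y))).
1,2: by apply: (boxed_form_sxy le_nK) => a b c /andP[/andP[/and4P[]]].
all: move=> s x y /andP[/andP[/and4P[]]]; rewrite /form_sxy => Q os xy x3 x2 x4 _.
all: rewrite ?opprK; split=> //; last by rewrite subrr.
all: by rewrite /O4set /Oset /Eset /form_sxy; lia.
Qed.

(* The involution is complex conjugation transported by a rotation. *)
Lemma zsum_O4set :
  zsum K O4set (fun s x _ => chi4 s * x) = zsum K O4set (fun s _ y => chi4 s * y).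
Proof.
apply/eqP; rewrite -subr_eq0 -zsumN -zsumD; apply/eqP/F7_eqN0; rewrite -zsumN.
apply: (@zsum_reindex _ _ _ _ _ (fun s x y => (s, ((3 * y - x) %/ 2)%Z, ((x + y) %/ 2)%Z))
  (fun s x y => (s, ((3 * y - x) %/ 2)%Z, ((x + y) %/ 2)%Z))).
1,2: by apply: (boxed_form_sxy le_nK) => a b c /andP[/andP[/and4P[]]].
all: move=> s x y /andP[/andP[/and4P[]]]; rewrite /form_sxy => Q os xy x3 x2 x4 _.
all: have [k xk] : exists k, x = y + 4 * k by exists ((x - y) %/ 4)%Z; lia.
all: have -> : ((3 * y - x) %/ 2)%Z = y - 2 * k by lia.
all: have -> : ((x + y) %/ 2)%Z = y + 2 * k by lia.
all: subst x; split;
  [by rewrite /O4set /Oset /Eset /form_sxy; lia | by congr (_, _, _); lia |].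
all: by rewrite (_ : _ - _ = 0) //; ring.
Qed.

(** The weight [(a + 1) / 2] is the bilateral index in Jacobi's identity; adding the image of the
    sum under [a -> -a] replaces it by [a], and the preceding reductions apply. *)
Lemma zsum_Aset : zsum K (Aset n) (fun a _ _ => chi4 a * ((a + 1) %/ 2)%Z) =
  zsum K O4set (fun s _ y => chi4 s * y).
Proof.
set S := LHS; set O := RHS.
have dbl : 2 * S = zsum K (Aset n) (fun a _ _ => chi4 a * a).
{ have SN : S = zsum K (Aset n) (fun a _ _ => - (chi4 a * ((1 - a) %/ 2)%Z)).
  { apply: (@zsum_reindex _ _ _ _ _ (fun a b c => (- a, b, c)) (fun a b c => (- a, b, c))).
    1,2: by apply: (boxed_three_squares le_nK) => a b c /and4P[].
    all: move=> a b c /and4P[]; rewrite /three_squares => Q oa ob oc _.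
    all: rewrite ?opprK; split=> //; first by rewrite /Aset /three_squares; lia.
    all: rewrite chi4N; last by lia.
    all: by rewrite ?[1 + a]addrC ?[- a + 1]addrC mulNr ?opprK ?subrr ?addNr. }
  rewrite mulr_natl mulr2n {2}SN /S -zsumD; apply: eq_zsum => // a b c /and4P[_ oa _ _].
  rewrite -mulrBr -mulrBr (_ : _ - _ - _ = 0) ?mulr0 //; lia. }
have E : 2 * S = 2 * O.
  rewrite dbl (Aset_Lset le_nK) (Lset_Dset le_nK) zsum_Dset Dset_Eset.
  rewrite zsum_Eset zsum_Oset_x zsum_O4set.
  (* The reductions contribute the factors 2, -1, 2, -2 and 2, with product 16, which is 2 modulo
     7. *)
  rewrite -/O -[RHS]addr0 (_ : 0 = 7 * (2 * O)); first by ring.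
  by rewrite -[7](_ : 0 = _) ?mul0r //; apply/eqP.
by move/eqP: E; rewrite -subr_eq0 -mulrBr mulf_eq0 => /orP[/eqP//|]; rewrite subr_eq0 => /eqP.
Qed.

(** The index set of [f_7 f_2 f_2^3] after completing squares: [s] and [x] come from Euler's
    identity, [y] from Jacobi's. *)
Definition Cset (s x y : int) : bool := [&& form_sxy n s x y,
  (s %% 6)%Z == 5, (x %% 6)%Z == 5 & (y %% 2)%Z == 1].

(** After the same doubling in [y], the map [x -> -x] carries [Cset] to [Oset] and yields the sign.
    On [O4set] the characters of [x] and [y] cancel, and [y -> -y] identifies the other half of
    [Oset] with it. *)
Lemma zsum_Cset : zsum K Cset (fun s x y => chi4 s * chi4 x * (chi4 y * ((y + 1) %/ 2)%Z)) =
  - zsum K O4set (fun s _ y => chi4 s * y).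
Proof.
set S := LHS; set O := zsum K O4set _.
have dbl : 2 * S = zsum K Cset (fun s x y => chi4 s * chi4 x * (chi4 y * y)).
{ have SN : S = zsum K Cset (fun s x y => - (chi4 s * chi4 x * (chi4 y * ((1 - y) %/ 2)%Z))).
  { apply: (@zsum_reindex _ _ _ _ _ (fun a b c => (a, b, - c)) (fun a b c => (a, b, - c))).
    1,2: by apply: (boxed_form_sxy le_nK) => a b c /and4P[].
    all: move=> s x y /and4P[]; rewrite /form_sxy => Q os ox oy _.
    all: rewrite ?opprK; split=> //; first by rewrite /Cset /form_sxy; lia.
    all: rewrite chi4N; last by lia.
    all: by rewrite ?[1 + y]addrC ?[- y + 1]addrC mulNr mulrN ?opprK ?subrr ?addNr. }
  rewrite mulr_natl mulr2n {2}SN /S -zsumD; apply: eq_zsum => // s x y /and4P[_ _ _ oy].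
  rewrite -mulrBr -mulrBr -mulrBr -mulrBr (_ : _ - _ - _ = 0) ?mulr0 //; lia. }
have EO : zsum K Cset (fun s x y => chi4 s * chi4 x * (chi4 y * y)) =
    - zsum K Oset (fun s x y => chi4 s * chi4 x * (chi4 y * y)).
{ rewrite -zsumN.
  apply: (@zsum_reindex _ _ _ _ _ (fun a b c => (a, - b, c)) (fun a b c => (a, - b, c))).
  - by apply: (boxed_form_sxy le_nK) => a b c /and4P[].
  - by apply: (boxed_form_sxy le_nK) => a b c /andP[/and4P[]].
  - move=> s x y /and4P[]; rewrite /form_sxy => Q os ox oy _.
    rewrite opprK; split=> //; first by rewrite /Oset /Eset /form_sxy; lia.
    by rewrite chi4N; [rewrite mulrN mulNr opprK subrr | lia].
  move=> s x y /andP[/and4P[]]; rewrite /form_sxy => Q os xy x3 x2 _.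
  rewrite opprK; split=> //; first by rewrite /Cset /form_sxy; lia.
  by rewrite chi4N; [rewrite mulrN mulNr subrr | lia]. }
have E : 2 * S = 2 * - O.
{ rewrite dbl EO mulrN; congr (- _).
  rewrite (zsum_split K Oset (fun _ x y => ((x - y) %% 4)%Z == 0)) mulr_natl mulr2n.
  have half : zsum K O4set (fun s x y => chi4 s * chi4 x * (chi4 y * y)) = O.
    apply: eq_zsum => // s x y; rewrite /O4set /Oset /Eset => H.
    by rewrite /chi4; do 3!case: ifP; lia.
  rewrite half; congr (_ + _); rewrite -half.
  apply: (@zsum_reindex _ _ _ _ _ (fun s x y => (s, x, - y)) (fun s x y => (s, x, - y))).
  1,2: by apply: (boxed_form_sxy le_nK) => a b c /andP[/andP[/and4P[]]].
  all: move=> s x y /andP[/andP[/and4P[]]]; rewrite /form_sxy => Q os xy x3 x2 x4 _.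
  all: rewrite ?opprK; split=> //; first by rewrite /O4set /Oset /Eset /form_sxy; lia.
  all: by rewrite chi4N; [rewrite mulrNN subrr | lia]. }
by move/eqP: E; rewrite -subr_eq0 -mulrBr mulf_eq0 => /orP[/eqP//|]; rewrite subr_eq0 => /eqP.
Qed.

End EisensteinSums.

(** * Coefficients of theta products as lattice sums *)

Section ThetaCoefficients.
Local Open Scope ring_scope.

Lemma coef_theta3 (R : comNzRingType) K (w1 w2 w3 : int -> R) (e1 e2 e3 : int -> nat) m :
  ((\sum_(a <- zbox K) w1 a *: 'X^(e1 a)) * (\sum_(b <- zbox K) w2 b *: 'X^(e2 b))
    * (\sum_(c <- zbox K) w3 c *: 'X^(e3 c)))`_m =
  \sum_(v <- zbox3 K | (e1 v.1.1 + e2 v.1.2 + e3 v.2 == m)%N)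
     w1 v.1.1 * w2 v.1.2 * w3 v.2.
Proof.
rewrite (_ : _ * _ * _ = \sum_(v <- zbox3 K) (w1 v.1.1 * w2 v.1.2 * w3 v.2) *:
    'X^(e1 v.1.1 + e2 v.1.2 + e3 v.2)).
  rewrite coef_sum [RHS]big_mkcond; apply: eq_bigr => v _.
  by rewrite coefZ coefXn eq_sym; case: eqP; rewrite ?mulr1 ?mulr0.
rewrite -(big_zbox3 K (fun a b c => (w1 a * w2 b * w3 c) *: 'X^(e1 a + e2 b + e3 c))).
rewrite !mulr_suml; apply: eq_bigr => a _.
rewrite [X in X * _]mulr_sumr mulr_suml; apply: eq_bigr => b _.
rewrite mulr_sumr; apply: eq_bigr => c _.
by rewrite -!mul_polyC !polyCM !exprD; ring.
Qed.

Lemma sign_F7 (j : int) : (-1) ^+ `|j| = (par j)%:~R :> 'F_7.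
Proof.
rewrite -signr_odd /par; case: ifP => j2.
  by have -> : odd `|j| = false by lia.
by have -> : odd `|j| = true by lia.
Qed.

Definition jac_weight (j : int) : int := chi4 (2 * j - 1) * j.

Lemma jac_weightE (j : int) : - j%:~R * (-1) ^+ `|j| = (jac_weight j)%:~R :> 'F_7.
Proof.
rewrite sign_F7 -rmorphN -rmorphM /=; congr (_%:~R).
by rewrite /par /jac_weight /chi4; do 2!case: ifP; lia.
Qed.

Lemma theta_expE01 (j : int) : (theta_exp 0 1 j)%:Z * 2 = j * j - j.
Proof. by rewrite theta_expE; ring. Qed.

Lemma theta_expE12 (j : int) : (theta_exp 1 2 j)%:Z * 2 = 3 * (j * j) - j.
Proof. by rewrite theta_expE; ring. Qed.

Lemma theta_expE13 (j : int) : (theta_exp 1 3 j)%:Z = 2 * (j * j) - j.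
Proof. by have := theta_expE 1 3 j; rewrite expr2; lia. Qed.

Notation eul7 := (@eul 'F_7).

Lemma coef_eul1_eul2_4 N n K : (7 * n + 4 < N)%N -> (2 * N <= K)%N -> (56 * n + 35 <= K)%N ->
  (eul7 1 N * eul7 2 N ^+ 4)`_(7 * n + 4) = zsum K (O4set n) (fun s _ y => chi4 s * y).
Proof.
move=> lt_nN le_NK le_nK; have N_gt0 : (0 < N)%N by lia.
pose psi : {poly 'F_7} := \sum_(j <- zbox K) 1 *: 'X^(theta_exp 1 3 j).
pose jac : {poly 'F_7} := \sum_(j <- zbox K) (jac_weight j)%:~R *: 'X^(theta_exp 0 1 j).
have gauss : eqX N (eul7 1 N * psi) (eul7 2 N ^+ 2).
  apply: eqX_trans (gauss_theta _ N_gt0 le_NK); apply: eqXM => //.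
  by apply: eqX_sum => j _; rewrite scale1r.
have jacobi : eqX N (eul7 1 N ^+ 3) jac.
  apply: eqX_trans (jacobi_theta _ N_gt0 le_NK) _.
  by apply: eqX_sum => j _; rewrite jac_weightE.
have prod : eqX N (eul7 1 N * eul7 2 N ^+ 4) (jac * psi * psi).
  apply: (@eqX_trans _ _ (eul7 1 N ^+ 3 * (psi * psi))); last first.
    by rewrite -mulrA; apply: eqXM.
  have -> : eul7 1 N ^+ 3 * (psi * psi) =
      eul7 1 N * ((eul7 1 N * psi) * (eul7 1 N * psi)) by ring.
  have -> : eul7 2 N ^+ 4 = eul7 2 N ^+ 2 * eul7 2 N ^+ 2 by ring.
  by apply: eqXM => //; apply: eqXM; apply: eqX_sym.
rewrite (prod _ lt_nN) coef_theta3 -(zsum_Aset le_nK).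
under eq_bigr do rewrite !mulr1.
apply: (@zsum_reindex K
  (fun i j k => (theta_exp 0 1 i + theta_exp 1 3 j + theta_exp 1 3 k == 7 * n + 4)%N)
  _ (fun i _ _ => jac_weight i) _
  (* Eight times the exponent plus 3 is the sum of the squares of these entries, and
     [8 (7 n + 4) + 3 = 7 (8 n + 5)]. *)
  (fun i j k => (2 * i - 1, 4 * j - 1, 4 * k - 1))
  (fun a b c => (((a + 1) %/ 2)%Z, ((b + 1) %/ 4)%Z, ((c + 1) %/ 4)%Z))).
- move=> i j k /eqP; have := theta_expE01 i; have := theta_expE13 j; have := theta_expE13 k.
  by nia.
- by apply: (boxed_three_squares le_nK) => a b c /and4P[].
- move=> i j k /eqP; have := theta_expE01 i; have := theta_expE13 j; have := theta_expE13 k.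
  move=> Ek Ej Ei E _; split; first by rewrite /Aset /three_squares; apply/and4P; split; lia.
    by congr (_, _, _); lia.
  by rewrite /jac_weight (_ : ((2 * i - 1 + 1) %/ 2)%Z = i) ?subrr; lia.
move=> a b c /and4P[]; rewrite /three_squares => sq oa ob oc _.
have [i ai] : exists i, a = 2 * i - 1 by exists ((a + 1) %/ 2)%Z; lia.
have [j bj] : exists j, b = 4 * j - 1 by exists ((b + 1) %/ 4)%Z; lia.
have [k ck] : exists k, c = 4 * k - 1 by exists ((c + 1) %/ 4)%Z; lia.
have -> : ((a + 1) %/ 2)%Z = i by lia.
have -> : ((b + 1) %/ 4)%Z = j by lia.
have -> : ((c + 1) %/ 4)%Z = k by lia.
subst a b c; split => //; last by rewrite /jac_weight subrr.
by have := theta_expE01 i; have := theta_expE13 j; have := theta_expE13 k; lia.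
Qed.

Lemma eul2_cube_theta N K : (0 < N)%N -> (2 * N <= K)%N ->
  eqX N (eul7 2 N ^+ 3) (\sum_(j <- zbox K) (jac_weight j)%:~R *: 'X^(2 * theta_exp 0 1 j)).
Proof.
move=> N_gt0 le_NK.
have -> : eul7 2 N = eul7 1 N \Po 'X^2 by rewrite eul_comp_Xn.
rewrite -rmorphXn /=.
apply: eqX_trans (eqX_comp_Xn _ (jacobi_theta _ N_gt0 le_NK)) _ => //.
rewrite rmorph_sum /=; apply: eqX_sum => j _.
by rewrite comp_polyZ comp_Xn_poly -exprM jac_weightE.
Qed.

Lemma coef_eul7_eul2_4 N n K : (n < N)%N -> (2 * N <= K)%N -> (56 * n + 35 <= K)%N ->
  (eul7 7 N * eul7 2 N ^+ 4)`_n = - zsum K (O4set n) (fun s _ y => chi4 s * y).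
Proof.
move=> lt_nN le_NK le_nK; have N_gt0 : (0 < N)%N by lia.
have euler d : (0 < d)%N ->
    eqX N (eul7 d N) (\sum_(j <- zbox K) (par j)%:~R *: 'X^(d * theta_exp 1 2 j)).
  move=> d_gt0; rewrite -[d]muln1 -eul_comp_Xn muln1.
  apply: eqX_trans (eqX_comp_Xn d_gt0 (euler_theta _ N_gt0 le_NK)) _.
  rewrite rmorph_sum /=; apply: eqX_sum => j _.
  by rewrite comp_polyZ comp_Xn_poly -exprM sign_F7.
have prod := eqXM (eqXM (euler 7 isT) (euler 2 isT)) (eul2_cube_theta N_gt0 le_NK).
rewrite (_ : _ * _ = eul7 7 N * eul7 2 N * eul7 2 N ^+ 3); last by ring.
rewrite (prod _ lt_nN) coef_theta3 -(zsum_Cset le_nK).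
under eq_bigr do rewrite -!rmorphM.
apply: (@zsum_reindex K
  (fun i j k => (7 * theta_exp 1 2 i + 2 * theta_exp 1 2 j + 2 * theta_exp 0 1 k == n)%N)
  _ (fun i j k => par i * par j * jac_weight k) _
  (* The form [7 s^2 + 2 x^2 + 6 y^2] at these entries is 24 times the exponent plus 15. *)
  (fun i j k => (6 * i - 1, 6 * j - 1, 2 * k - 1))
  (fun a b c => (((a + 1) %/ 6)%Z, ((b + 1) %/ 6)%Z, ((c + 1) %/ 2)%Z))).
- move=> i j k /eqP; have := theta_expE12 i; have := theta_expE12 j; have := theta_expE01 k.
  by nia.
- by apply: (boxed_form_sxy le_nK) => a b c /and4P[].
- move=> i j k /eqP; have := theta_expE12 i; have := theta_expE12 j; have := theta_expE01 k.
  move=> Ek Ej Ei E _; split; first by rewrite /Cset /form_sxy; apply/and4P; split; lia.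
    by congr (_, _, _); lia.
  rewrite /jac_weight (_ : ((2 * k - 1 + 1) %/ 2)%Z = k); last by lia.
  by rewrite /par /chi4; do 5!case: ifP; lia.
move=> a b c /and4P[]; rewrite /form_sxy => sq oa ob oc _.
have [i ai] : exists i, a = 6 * i - 1 by exists ((a + 1) %/ 6)%Z; lia.
have [j bj] : exists j, b = 6 * j - 1 by exists ((b + 1) %/ 6)%Z; lia.
have [k ck] : exists k, c = 2 * k - 1 by exists ((c + 1) %/ 2)%Z; lia.
have -> : ((a + 1) %/ 6)%Z = i by lia.
have -> : ((b + 1) %/ 6)%Z = j by lia.
have -> : ((c + 1) %/ 2)%Z = k by lia.
subst a b c; split => //.
  by have := theta_expE12 i; have := theta_expE12 j; have := theta_expE01 k; lia.
by rewrite /jac_weight /par /chi4; do 5!case: ifP; lia.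
Qed.

(** Both coefficients are, up to sign, the same sum over [O4set]. *)
Lemma coef_eul1_eul2_4_mod7 N n : (7 * n + 4 < N)%N ->
  (eul7 1 N * eul7 2 N ^+ 4)`_(7 * n + 4) = - (eul7 7 N * eul7 2 N ^+ 4)`_n.
Proof.
move=> lt_nN; rewrite (@coef_eul1_eul2_4 N n (56 * N)); try by lia.
by rewrite (@coef_eul7_eul2_4 N n (56 * N)) ?opprK //; lia.
Qed.

(** The exponents are [j^2 - j], which is never 1, 3 or 4 modulo 7 and is 5 only if [j] is 4. In
    that class [1 - j] is congruent to [j], so the terms [j] and [1 - j] cancel: the Jacobi
    coefficient [2 j - 1] is divisible by 7. *)
Lemma coef_eul2_cube N m : (m < N)%N -> (m %% 7)%N \in [:: 1; 3; 4; 5] ->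
  (eul7 2 N ^+ 3)`_m = 0.
Proof.
move=> lt_mN m7; have N_gt0 : (0 < N)%N by lia.
pose K := (2 * N)%N.
rewrite (eul2_cube_theta N_gt0 (leqnn _) lt_mN) -/K coef_sum.
rewrite (_ : \sum_(j <- _) _ =
    \sum_(j <- zbox K | (2 * theta_exp 0 1 j == m)%N) (jac_weight j)%:~R); last first.
  rewrite [RHS]big_mkcond; apply: eq_bigr => j _.
  by rewrite coefZ coefXn eq_sym; case: eqP; rewrite ?mulr1 ?mulr0.
have box (j : int) : (2 * theta_exp 0 1 j == m)%N -> j \in zbox K.
  by rewrite mem_zbox /K => /eqP; have := theta_expE01 j; nia.
have j7 (j : int) : (2 * theta_exp 0 1 j == m)%N -> (j %% 7)%Z = 4.
{ move/eqP=> E; have {E} : m%:Z = j * j - j by have := theta_expE01 j; lia.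
  have [k [r [-> r7]]] : exists k r : int, j = 7 * k + r /\ 0 <= r < 7.
    by exists (j %/ 7)%Z, (j %% 7)%Z; lia.
  rewrite (_ : _ - _ = 7 * (7 * (k * k) + 2 * (k * r) - k) + (r * r - r)); last by ring.
  move: (7 * _ + _ - _) => z.
  have : r = 0 \/ r = 1 \/ r = 2 \/ r = 3 \/ r = 4 \/ r = 5 \/ r = 6 by lia.
  by move: m7; rewrite !inE => m7 [->|[->|[->|[->|[->|[->|->]]]]]]; lia. }
apply: F7_eqN0; rewrite -sumrN; under [RHS]eq_bigr do rewrite -rmorphN.
apply: (@sum_F7_reindex _ _ _ _ jac_weight (fun j => - jac_weight j)
  (fun j => 1 - j) (fun j => 1 - j)).
- exact: zbox_uniq.
- exact: box.
- exact: box.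
all: move=> j jm _; have j4 := j7 j jm.
all: split; [by have := theta_expE01 j; have := theta_expE01 (1 - j); lia | by lia |].
all: by rewrite /jac_weight /chi4; do 2!case: ifP; lia.
Qed.

End ThetaCoefficients.

(** * The generating function of [p4] *)

Section GeneratingFunction.
Local Open Scope ring_scope.
Variable R : comNzRingType.

Lemma eqX_prod1 N (I : Type) (t : seq I) (P : pred I) (F : I -> {poly R}) :
  (forall i, P i -> eqX N (F i) 1) -> eqX N (\prod_(i <- t | P i) F i) 1.
Proof.
move=> F1; apply: (big_ind (fun p => eqX N p 1)) => // p q p1 q1.
by rewrite -[1 in X in eqX _ _ X](mulr1 1); apply: eqXM.
Qed.

Lemma eqX_subXn N n : (N <= n)%N -> eqX N (1 - 'X^n : {poly R}) 1.
Proof. by move=> le_Nn i lt_iN; rewrite coefB coefXn ltn_eqF ?subr0 // (leq_trans lt_iN). Qed.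

Definition geom n i : {poly R} := \sum_(k < n.+1) 'X^(k * i.+1).

Lemma geom_mul n i : eqX n.+1 (geom n i * (1 - 'X^(i.+1))) 1.
Proof.
have -> : geom n i * (1 - 'X^(i.+1)) = 1 - 'X^(i.+1 * n.+1).
  rewrite exprM -[in RHS]opprB subrX1 -[in LHS]opprB mulrN mulrC; congr (- (_ * _)).
  by apply: eq_bigr => k _; rewrite mulnC exprM.
by apply: eqX_subXn; nia.
Qed.

(** The zero branch removes the multiplicities forbidden to the second color, so that expanding
    [p4_poly] leaves one monomial for each admissible multiplicity function. *)
Definition p4_factor n (x : 'I_n * bool) (k : 'I_n.+1) : {poly R} :=
  if (x.2 && (0 < k)%N) ==> (4 %| x.1.+1)%N then 'X^(k * x.1.+1) else 0.

Definition p4_poly n : {poly R} := \prod_(x : 'I_n * bool) \sum_(k < n.+1) p4_factor x k.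

Lemma coef_p4_poly n : (p4_poly n)`_n = (p4 n)%:R.
Proof.
rewrite /p4_poly bigA_distr_bigA /= coef_sum /p4 -sum1_card natr_sum [RHS]big_mkcond /=.
apply: eq_bigr => f _; rewrite inE /is_2color_partition.
case: (boolP (second_color_mult4 f)) => [/forallP f4|/forallPn[i]].
  rewrite andbT (eq_bigr (fun x : 'I_n * bool => 'X^(f x * x.1.+1))); last first.
    move=> [i b] _; rewrite /p4_factor /=; case: b => //=.
    by rewrite (f4 i).
  rewrite -expr_sum coefXn eq_sym.
  by case: eqP.
rewrite andbF negb_imply => /andP[fi i4]; rewrite (bigD1 (i, true)) //= {1}/p4_factor /=.
by rewrite fi (negPf i4) mul0r coef0.
Qed.

Lemma p4_poly_split n :
  p4_poly n = (\prod_(i < n) geom n i) * \prod_(i < n | (4 %| i.+1)%N) geom n i.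
Proof.
rewrite /p4_poly.
rewrite -(pair_bigA_idem _ (fun i b => \sum_(k < n.+1) p4_factor (i, b) k)) /=;
  last by rewrite mulr1.
rewrite [X in _ * X]big_mkcond -big_split /=; apply: eq_bigr => i _.
rewrite big_bool /= mulrC; congr (_ * _); rewrite /p4_factor /=.
case: ifP => i4; first by apply: eq_bigr => k _; rewrite implybT.
by rewrite big_ord_recl /= big1 ?addr0.
Qed.

Lemma prod_mul4 M : \prod_(i < 4 * M | (4 %| i.+1)%N) (1 - 'X^(i.+1)) = eul R 4 M.
Proof.
elim: M => [|M IH]; first by rewrite big_ord0 /eul qpoch0.
rewrite big_mkcond mulnS /= !big_ord_recr /= -big_mkcond IH /eul qpochS -exprM.
have -> : (4 %| (4 * M).+1)%N = false by lia.
have -> : (4 %| (4 * M).+2)%N = false by lia.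
have -> : (4 %| (4 * M).+3)%N = false by lia.
have -> : (4 %| (4 * M).+4)%N by lia.
by rewrite !mulr1 mulnS.
Qed.

Lemma p4_poly_inv n : eqX n.+1 (p4_poly n * (eul R 1 n.+1 * eul R 4 n.+1)) 1.
Proof.
have E1 : eqX n.+1 (\prod_(i < n) (1 - 'X^(i.+1))) (eul R 1 n.+1).
  exact: (@eqX_qpoch R n.+1 1 n isT (leqnn _)).
have E4 : eqX n.+1 (\prod_(i < n | (4 %| i.+1)%N) (1 - 'X^(i.+1))) (eul R 4 n.+1).
  (* The factors beyond index [n] are 1 modulo [X^(n + 1)]. *)
  rewrite -prod_mul4 -(subnKC (_ : n <= 4 * n.+1)%N); last by lia.
  rewrite big_mkcond [X in eqX _ _ X]big_mkcond big_split_ord /=.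
  rewrite -[X in eqX _ X _]mulr1; apply: eqXM => //; apply: eqX_sym.
  apply: eqX_prod1 => i _; case: ifP => // _.
  by apply: eqX_subXn; lia.
apply: (eqX_trans (eqXM (@eqX_refl _ _ _) (eqXM (eqX_sym E1) (eqX_sym E4)))).
rewrite p4_poly_split mulrACA -!big_split /=.
rewrite -[1 in X in eqX _ _ X](mulr1 1); apply: eqXM; apply: eqX_prod1 => i _; exact: geom_mul.
Qed.

Lemma coef_comp_opp (p : {poly R}) i : (p \Po (- 'X))`_i = (-1) ^+ i * p`_i.
Proof.
rewrite -[p in LHS]coefK -[p in RHS]coefK poly_def rmorph_sum !coef_sum /= mulr_sumr.
apply: eq_bigr => k _.
rewrite comp_polyZ comp_Xn_poly -scaleN1r exprZn !coefZ coefXn.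
by case: eqP => [->|_]; rewrite ?mulr1 ?mulr0 // mulrC.
Qed.

(** Substituting [-X] in [p4_poly_inv] leaves [f_4] unchanged; multiplying by [f_1] brings in the
    left side of [eul_sign_product]. *)
Lemma p4_poly_opp n : eqX n.+1 ((p4_poly n \Po (- 'X)) * eul R 2 n.+1 ^+ 3) (eul R 1 n.+1).
Proof.
pose N := n.+1.
have opp (p q : {poly R}) : eqX N p q -> eqX N (p \Po (- 'X)) (q \Po (- 'X)).
  by move=> pq i lt_iN; rewrite !coef_comp_opp pq.
have eul4_opp : eul R 4 N \Po (- 'X) = eul R 4 N.
  apply/polyP => i; rewrite coef_comp_opp.
  have -> : eul R 4 N = eul R 1 N \Po 'X^4 by rewrite eul_comp_Xn.
  rewrite coef_comp_poly_Xn //; case: ifP => [i4|]; last by rewrite mulr0.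
  by rewrite -signr_odd (_ : odd i = false) ?mul1r //; lia.
have inv := opp _ _ (@p4_poly_inv n).
rewrite !rmorphM /= eul4_opp rmorph1 in inv.
set G := p4_poly n \Po _ in inv *.
have le1 : (N <= N.*2.+1)%N by lia.
have E1 := @eqX_qpoch R N 1 N.*2 isT le1; have E2 := @eqX_qpoch R N 2 N.*2 isT le1.
apply: (@eqX_trans _ _ (G * ((eul R 1 N.*2 \Po (- 'X)) * eul R 1 N.*2 * eul R 4 N))).
  apply: eqXM => //; rewrite eul_sign_product (exprSr _ 2).
  by apply: eqXM => //; apply: eqX_sym.
apply: (@eqX_trans _ _ (G * ((eul R 1 N \Po (- 'X)) * eul R 4 N) * eul R 1 N)); last first.
  by rewrite -[X in eqX _ _ X]mul1r; apply: eqXM.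
rewrite -[X in eqX _ _ X]mulrA [X in eqX _ (_ * X) _]mulrAC.
apply: eqXM => //; apply: eqXM => //; apply: eqXM => //.
exact: opp.
Qed.

End GeneratingFunction.

(** * Extraction of coefficients along an arithmetic progression *)

Section ProgressionCoefficients.
Local Open Scope ring_scope.
Variable R : comNzRingType.

Definition extract m r (p : {poly R}) : {poly R} := \poly_(i < size p) p`_(m * i + r).

Lemma coef_extract m r p i : (0 < m)%N -> (extract m r p)`_i = p`_(m * i + r).
Proof.
move=> m_gt0; rewrite coef_poly; case: ltnP => // le_pi.
rewrite nth_default // (leq_trans le_pi) // (leq_trans (leq_pmull i m_gt0)) //.
exact: leq_addr.
Qed.

(** A factor that is a polynomial in [X^m] does not mix residue classes of exponents and can be
    pulled out. *)
Lemma extract_mul_comp m r p q : (r < m)%N ->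
  extract m r (p * (q \Po 'X^m)) = extract m r p * q.
Proof.
move=> lt_rm; have m_gt0 : (0 < m)%N by lia.
apply/polyP => i; rewrite coef_extract // -[q in LHS]coefK -[q in RHS]coefK !poly_def.
rewrite rmorph_sum /= !mulr_sumr !coef_sum; apply: eq_bigr => j _.
rewrite comp_polyZ comp_Xn_poly -exprM -!scalerAr !coefZ !coefMXn; congr (_ * _).
case: (ltnP i j) => [lt_ij|le_ji].
  by have -> : (m * i + r < m * j)%N by nia.
have -> : (m * i + r < m * j)%N = false by nia.
by rewrite coef_extract //; congr (_`_ _); nia.
Qed.

End ProgressionCoefficients.

(** * The congruence modulo 7 *)

Section Congruence.
Local Open Scope ring_scope.

Lemma eul2_exp7 n : eul 'F_7 2 n ^+ 7 = eul 'F_7 2 n \Po 'X^7.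
Proof.
have char7 : 7%N \in [pchar {poly 'F_7}] by rewrite pchar_poly pchar_Fp.
rewrite eul_comp_Xn /eul /qpoch -prodrXl; apply: eq_bigr => i _.
rewrite -!exprM -(pFrobenius_autE char7) rmorphB rmorph1 /= pFrobenius_autE -exprM.
by congr (1 - 'X^_); lia.
Qed.

Lemma p4_F7 n t : t \in [:: 11; 25; 32; 39]%N -> (p4 (49 * n + t))%:R = 0 :> 'F_7.
Proof.
(* Each [t] is 4 modulo 7, with quotient 1, 3, 4 or 5; these are the classes of [coef_eul2_cube]. *)
move=> ht; pose n1 := (7 * n + t %/ 7)%N.
have n0E : (49 * n + t = 7 * n1 + 4)%N by move: ht; rewrite !inE /n1; lia.
have r7 : ((t %/ 7)%N \in [:: 1; 3; 4; 5]%N) && (t %/ 7 < 7)%N by move: ht; rewrite !inE; lia.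
case/andP: r7 => r7 lt_r7.
rewrite -coef_p4_poly n0E; set n0 := (7 * n1 + 4)%N.
pose G := p4_poly 'F_7 n0 \Po (- 'X).
suff : G`_n0 = 0.
  by rewrite coef_comp_opp => /eqP; rewrite mulf_eq0 signr_eq0 => /eqP.
pose e d := eul 'F_7 d n0.+1.
(* Multiplying [p4_poly_opp] by [f_2^4] completes [f_2^3] to a seventh power, which Frobenius turns
   into a polynomial in [X^7]. *)
have Ge : eqX n0.+1 (G * (e 2%N \Po 'X^7)) (e 1%N * e 2%N ^+ 4).
  rewrite -eul2_exp7 (exprD _ 3 4) mulrA; apply: eqXM => //; exact: p4_poly_opp.
have UG : eqX n1.+1 (extract 7 4 G * e 2%N) (- (e 7%N * e 2%N ^+ 3) * e 2%N).
  rewrite -extract_mul_comp // => i lt_i; rewrite coef_extract // Ge; last by rewrite /n0; lia.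
  rewrite coef_eul1_eul2_4_mod7; last by rewrite /n0; lia.
  by rewrite mulNr coefN -mulrA -exprSr.
have {}UG : eqX n1.+1 (extract 7 4 G) (- (e 7%N * e 2%N ^+ 3)).
  apply: (@eqX_cancel _ _ _ _ (e 2%N)); first exact: coef0_qpoch.
  by rewrite ![e 2%N * _]mulrC.
rewrite -[n0]/(7 * n1 + 4)%N -coef_extract // UG // coefN mulrC.
have -> : e 7%N = e 1%N \Po 'X^7 by rewrite /e eul_comp_Xn.
(* As [f_7] is a polynomial in [X^7], the second extraction involves only coefficients of [f_2^3] in
   the class [t %/ 7]. *)
rewrite -coef_extract // extract_mul_comp // coefM big1 ?oppr0 // => i _.
rewrite coef_extract // coef_eul2_cube ?mul0r //.
  by have := ltn_ord i; rewrite /n0 /n1; lia.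
by rewrite mulnC modnMDl modn_small.
Qed.

End Congruence.

Theorem theorem1p2 (n t : nat) (ht : t \in [:: 11; 25; 32; 39]) :
  p4 (49 * n + t) = 0 %[mod 7].
Proof.
apply/eqP; rewrite mod0n -[_ == _]/(7 %| _).
by rewrite (dvdn_pcharf (pchar_Fp (isT : prime 7))); apply/eqP/p4_F7.
Qed.
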